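(* Let $\Gamma$ be a residually finite group and let $\Gamma$ act simplicially, cocompactly and with finite stabilizers on a flag complex $L$. Then the semi-direct product $G_L\rtimes\Gamma$ is also residually finite.
   Context: A flag complex is a simplicial complex $L$ (possibly infinite) such that every finite set of vertices of $L$ that are pairwise joined by edges is the vertex set of a simplex of $L$. For a flag complex $L$, the right-angled Artin group $G_L$ is the group with generators the vertices of $L$, subject only to the relations that the two ends of each edge of $L$ commute. A simplicial action of $\Gamma$ on $L$ permutes these generators and so induces an action of $\Gamma$ on $G_L$ by automorphisms; $G_L\rtimes\Gamma$ is the semi-direct product for this action. *)

(* Defs.v *)
From HB Require Import structures.
From mathcomp Require Import all_boot all_fingroup.
From mathcomp Require Import generic_quotient finmap.
From mathcomp Require Import boolp classical_sets cardinality.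

Set Implicit Arguments.
Unset Strict Implicit.
Unset Printing Implicit Defensive.

Local Open Scope quotient_scope.
Local Open Scope fset_scope.
Local Open Scope classical_set_scope.
Local Open Scope group_scope.

Definition residually_finite (G : groupType) : Prop :=
  forall x : G, x != 1 ->
    exists (Q : finGroupType) (f : {multiplicative G -> Q}), f x != 1.

(* The empty set is not a simplex: otherwise every action with finite simplex
   stabilizers would be an action of a finite group. *)
Record simplicial_complex (V : choiceType) := SimplicialComplex {
  simplices : set {fset V};
  simplex_neq0 : forall s, simplices s -> s != fset0;
  simplex_face : forall s t : {fset V},
    simplices s -> t != fset0 -> (t `<=` s)%fset -> simplices t;
  simplex_vertex : forall v, simplices [fset v]
}.

Definition edge (V : choiceType) (L : simplicial_complex V) (x y : V) : Prop :=
  x != y /\ simplices L [fset x; y].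

Definition flag_complex (V : choiceType) (L : simplicial_complex V) : Prop :=
  forall s : {fset V}, s != fset0 ->
    (forall x y, x \in s -> y \in s -> x != y -> edge L x y) ->
    simplices L s.

Record simplicial_action (Gamma : groupType) (V : choiceType)
    (L : simplicial_complex V) := SimplicialAction {
  sact :> Gamma -> V -> V;
  sact1 : forall v, sact 1 v = v;
  sactM : forall g h v, sact (g * h) v = sact g (sact h v);
  sact_simplex : forall g (s : {fset V}),
    simplices L s -> simplices L [fset sact g v | v in s]
}.

Section SimplicialAction.
Variables (Gamma : groupType) (V : choiceType) (L : simplicial_complex V).
Variable A : simplicial_action Gamma L.

Definition simplex_act (g : Gamma) (s : {fset V}) : {fset V} :=
  [fset A g v | v in s].

Definition simplex_orbit (s : {fset V}) : set {fset V} :=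
  [set simplex_act g s | g in [set: Gamma]].

(* For a simplicial action, compactness of |L| / Gamma amounts to finiteness of
   the set of orbits of simplices. *)
Definition cocompact : Prop :=
  finite_set [set simplex_orbit s | s in simplices L].

(* setwise *)
Definition simplex_stabilizer (s : {fset V}) : set Gamma :=
  [set g | simplex_act g s = s].

Definition finite_stabilizers : Prop :=
  forall s, simplices L s -> finite_set (simplex_stabilizer s).

End SimplicialAction.

(* The letter (v, b) stands for v if b = false and for v^-1 if b = true. *)
Notation word V := (seq (V * bool)).

Inductive pres_eq (V : Type) (R : word V -> word V -> Prop) :
    word V -> word V -> Prop :=
| PresRel u v of R u v : pres_eq R u v
| PresCancel x b : pres_eq R [:: (x, b); (x, ~~ b)] [::]
| PresRefl u : pres_eq R u u
| PresSym u v of pres_eq R u v : pres_eq R v u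
| PresTrans u v w of pres_eq R u v & pres_eq R v w : pres_eq R u w
| PresCat u u' v v' of pres_eq R u u' & pres_eq R v v' :
    pres_eq R (u ++ v) (u' ++ v').

Section Presentation.
Variables (V : choiceType) (R : word V -> word V -> Prop).

Definition pres_eqb : rel (word V) := fun u v => `[< pres_eq R u v >].

Lemma pres_eqb_equiv : equiv_class_of pres_eqb.
Proof.
split=> [u|u v|v u w].
- by apply/asboolP; exact: PresRefl.
- by apply/asboolP/asboolP; exact: PresSym.
- by move=> /asboolP uv /asboolP vw; apply/asboolP; exact: PresTrans uv vw.
Qed.

Canonical pres_equiv_rel := EquivRelPack pres_eqb_equiv.

Definition presented : Type := {eq_quot pres_eqb}.
HB.instance Definition _ := Choice.on presented.

Definition pres_class (u : word V) : presented := \pi_({eq_quot pres_eqb}) u.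
Definition pres_repr (q : presented) : word V :=
  repr (q : {eq_quot pres_eqb}).

Definition word_inv (u : word V) : word V :=
  rev [seq (a.1, ~~ a.2) | a <- u].

Lemma pres_classP u v : pres_class u = pres_class v <-> pres_eq R u v.
Proof. by split=> [/eqmodP/asboolP | uv] //; apply/eqmodP/asboolP. Qed.

Lemma pres_reprK q : pres_class (pres_repr q) = q.
Proof. exact: (@reprK _ {eq_quot pres_eqb}). Qed.

Lemma pres_reprP u : pres_eq R (pres_repr (pres_class u)) u.
Proof. by apply/pres_classP; rewrite pres_reprK. Qed.

Lemma word_invK : involutive word_inv.
Proof.
move=> u; rewrite /word_inv map_rev revK -map_comp -[RHS]map_id.
by apply: eq_map => -[x b] /=; rewrite negbK.
Qed.

Lemma word_inv_cat u v : word_inv (u ++ v) = word_inv v ++ word_inv u.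
Proof. by rewrite /word_inv map_cat rev_cat. Qed.

Lemma pres_eq_mulV u : pres_eq R (u ++ word_inv u) [::].
Proof.
elim: u => [|[x b] u IHu]; first exact: PresRefl.
rewrite -cat1s word_inv_cat -catA (catA u).
apply: PresTrans (PresCancel R x b).
apply: (@PresCat _ _ [:: (x, b)] [:: (x, b)] _ [:: (x, ~~ b)]).
  exact: PresRefl.
exact: (@PresCat _ _ _ [::] _ [:: (x, ~~ b)] IHu (PresRefl _ _)).
Qed.

Lemma pres_eq_Vmul u : pres_eq R (word_inv u ++ u) [::].
Proof. by rewrite -{2}[u]word_invK; exact: pres_eq_mulV. Qed.

Lemma pres_eq_inv u v : pres_eq R u v -> pres_eq R (word_inv u) (word_inv v).
Proof.
move=> uv; apply: (@PresTrans _ _ _ (word_inv u ++ (v ++ word_inv v))).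
  rewrite -{1}[word_inv u]cats0; apply: PresCat (PresRefl _ _) _.
  exact/PresSym/pres_eq_mulV.
rewrite catA -{2}[word_inv v]cat0s; apply: PresCat (PresRefl _ _).
apply: PresTrans (pres_eq_Vmul u).
by apply: PresCat (PresRefl _ _) _; exact: PresSym.
Qed.

Definition pres_one : presented := pres_class [::].
Definition pres_mul (p q : presented) : presented :=
  pres_class (pres_repr p ++ pres_repr q).
Definition pres_inv (p : presented) : presented :=
  pres_class (word_inv (pres_repr p)).

Lemma pres_class_cat u v :
  pres_class (u ++ v) = pres_mul (pres_class u) (pres_class v).
Proof. by apply/pres_classP/PresSym/PresCat; exact: pres_reprP. Qed.

Lemma pres_class_inv u : pres_class (word_inv u) = pres_inv (pres_class u).
Proof. exact/pres_classP/PresSym/pres_eq_inv/pres_reprP. Qed.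

Lemma pres_mulA : associative pres_mul.
Proof.
move=> p q r; rewrite -(pres_reprK p) -(pres_reprK q) -(pres_reprK r).
by rewrite -!pres_class_cat catA.
Qed.

Lemma pres_mul1g : left_id pres_one pres_mul.
Proof. by move=> p; rewrite -(pres_reprK p) -pres_class_cat. Qed.

Lemma pres_mulg1 : right_id pres_one pres_mul.
Proof. by move=> p; rewrite -(pres_reprK p) -pres_class_cat cats0. Qed.

Lemma pres_mulVg : left_inverse pres_one pres_inv pres_mul.
Proof.
move=> p; rewrite -(pres_reprK p) -pres_class_inv -pres_class_cat.
exact/pres_classP/pres_eq_Vmul.
Qed.

Lemma pres_mulgV : right_inverse pres_one pres_inv pres_mul.
Proof.
move=> p; rewrite -(pres_reprK p) -pres_class_inv -pres_class_cat.
exact/pres_classP/pres_eq_mulV.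
Qed.

HB.instance Definition _ := isGroup.Build presented
  pres_mulA pres_mul1g pres_mulg1 pres_mulVg pres_mulgV.

Definition pres_gen (x : V) : presented := pres_class [:: (x, false)].

Lemma pres_class1 : pres_class [::] = 1. Proof. by []. Qed.
Lemma pres_classM u v : pres_class (u ++ v) = pres_class u * pres_class v.
Proof. exact: pres_class_cat. Qed.

Definition word_eval (H : groupType) (f : V -> H) (u : word V) : H :=
  \prod_(a <- u) (if a.2 then (f a.1)^-1 else f a.1).

Lemma word_eval_cat (H : groupType) (f : V -> H) u v :
  word_eval f (u ++ v) = word_eval f u * word_eval f v.
Proof. exact: big_cat. Qed.

Lemma word_evalP (H : groupType) (f : V -> H) :
    (forall u v, R u v -> word_eval f u = word_eval f v) ->
  forall u v, pres_eq R u v -> word_eval f u = word_eval f v.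
Proof.
move=> fR u v; elim=> {u v} //; first 1 last.
- by move=> u v w _ -> _ ->.
- by move=> u u' v v' _ Eu _ Ev; rewrite !word_eval_cat Eu Ev.
move=> x b; rewrite /word_eval big_cons big_seq1 big_nil /=.
by case: b; rewrite /= ?mulgV ?mulVg.
Qed.

Definition pres_lift (H : groupType) (f : V -> H) (p : presented) : H :=
  word_eval f (pres_repr p).

Section Lift.
Variables (H : groupType) (f : V -> H).
Hypothesis fR : forall u v, R u v -> word_eval f u = word_eval f v.

Lemma pres_lift_class u : pres_lift f (pres_class u) = word_eval f u.
Proof. exact: word_evalP (pres_reprP u). Qed.

Lemma pres_lift_gen x : pres_lift f (pres_gen x) = f x.
Proof. by rewrite pres_lift_class /word_eval big_seq1. Qed.

Lemma pres_liftM : {morph pres_lift f : p q / p * q}.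
Proof.
move=> p q; rewrite -(pres_reprK p) -(pres_reprK q) -pres_classM.
by rewrite !pres_lift_class word_eval_cat.
Qed.
End Lift.

Lemma word_eval_morph (H : groupType) (f : presented -> H) u :
    {morph f : p q / p * q} ->
  f (pres_class u) = word_eval (f \o pres_gen) u.
Proof.
move=> fM; have f1 : f 1 = 1 by apply: (mulgI (f 1)); rewrite -fM !mulg1.
have fV p : f p^-1 = (f p)^-1.
  by apply: (mulgI (f p)); rewrite -fM !mulgV f1.
elim: u => [|[x b] u IHu]; first by rewrite /word_eval big_nil.
rewrite -cat1s pres_classM fM IHu word_eval_cat; congr (_ * _).
rewrite /word_eval big_seq1; case: b => //=; rewrite -fV; congr (f _).
exact: (pres_class_inv [:: (x, false)]).
Qed.

Lemma pres_morph_ext (H : groupType) (f g : presented -> H) :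
    {morph f : p q / p * q} -> {morph g : p q / p * q} ->
  (forall x, f (pres_gen x) = g (pres_gen x)) -> f =1 g.
Proof.
move=> fM gM fg p; rewrite -(pres_reprK p) !word_eval_morph //.
by apply: eq_bigr => -[x b] _ /=; rewrite fg.
Qed.

End Presentation.

Record group_action (Gamma N : groupType) := GroupAction {
  gact :> Gamma -> N -> N;
  gact1 : forall n, gact 1 n = n;
  gactM : forall g h n, gact (g * h) n = gact g (gact h n);
  gact_morph : forall g, {morph gact g : m n / m * n}
}.

Section SemiDirect.
Variables (Gamma N : groupType).

(* The unused argument carries the action, which determines the group law. *)
Definition semidirect of group_action Gamma N : Type := (N * Gamma)%type.

Variable A : group_action Gamma N.
HB.instance Definition _ := Choice.copy (semidirect A) (N * Gamma)%type.

Implicit Types p q : semidirect A.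

Definition sd_one : semidirect A := (1, 1).
Definition sd_mul p q : semidirect A := (p.1 * A p.2 q.1, p.2 * q.2).
Definition sd_inv p : semidirect A := (A p.2^-1 p.1^-1, p.2^-1).

Lemma gact_one g : A g 1 = 1.
Proof. by apply: (@mulgI _ (A g 1) (A g 1) 1); rewrite -gact_morph !mulg1. Qed.

Lemma sd_mulA : associative sd_mul.
Proof. by move=> p q r; rewrite /sd_mul /= gact_morph gactM !mulgA. Qed.

Lemma sd_mul1g : left_id sd_one sd_mul.
Proof. by case=> n g; rewrite /sd_mul /= gact1 !mul1g. Qed.

Lemma sd_mulg1 : right_id sd_one sd_mul.
Proof. by case=> n g; rewrite /sd_mul /= gact_one !mulg1. Qed.

Lemma sd_mulVg : left_inverse sd_one sd_inv sd_mul.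
Proof.
by case=> n g; rewrite /sd_mul /sd_inv /= -gact_morph !mulVg gact_one.
Qed.

Lemma sd_mulgV : right_inverse sd_one sd_inv sd_mul.
Proof.
by case=> n g; rewrite /sd_mul /sd_inv /= -gactM !mulgV gact1 mulgV.
Qed.

HB.instance Definition _ := isGroup.Build (semidirect A)
  sd_mulA sd_mul1g sd_mulg1 sd_mulVg sd_mulgV.

End SemiDirect.

Section RAAG.
Variables (V : choiceType) (L : simplicial_complex V).

Inductive raag_rel : word V -> word V -> Prop :=
| RaagRel x y of edge L x y :
    raag_rel [:: (x, false); (y, false)] [:: (y, false); (x, false)].

Definition raag : groupType := presented raag_rel.

Definition raag_gen (x : V) : raag := pres_gen raag_rel x.

Lemma raag_gen_comm x y : edge L x y ->
  raag_gen x * raag_gen y = raag_gen y * raag_gen x.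
Proof.
by move=> xy; rewrite -!pres_classM; apply/pres_classP/PresRel/RaagRel.
Qed.

Variables (Gamma : groupType) (A : simplicial_action Gamma L).

Lemma sact_inj g : injective (A g).
Proof.
by move=> x y xy; rewrite -[x](sact1 A) -[y](sact1 A) -(mulVg g) !sactM xy.
Qed.

Lemma sact_edge g x y : edge L x y -> edge L (A g x) (A g y).
Proof.
move=> [xy Lxy]; split; first by rewrite (inj_eq (@sact_inj g)).
by have := sact_simplex A g Lxy; rewrite imfsetU !imfset_fset1.
Qed.

Definition raag_act (g : Gamma) : raag -> raag :=
  pres_lift (fun x => raag_gen (A g x)).

Lemma raag_act_rel g u v : raag_rel u v ->
  word_eval (fun x => raag_gen (A g x)) u =
  word_eval (fun x => raag_gen (A g x)) v.
Proof.
case=> x y xy; rewrite /word_eval !big_cons big_nil !mulg1 /=.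
exact/raag_gen_comm/sact_edge.
Qed.

Lemma raag_act_gen g x : raag_act g (raag_gen x) = raag_gen (A g x).
Proof. exact: (pres_lift_gen (@raag_act_rel g)). Qed.

Lemma raag_act_morph g : {morph raag_act g : p q / p * q}.
Proof. exact: (pres_liftM (@raag_act_rel g)). Qed.

Lemma raag_act1 p : raag_act 1 p = p.
Proof.
apply: (@pres_morph_ext _ _ raag (raag_act 1) id) => // [|x].
  exact: raag_act_morph.
by rewrite raag_act_gen sact1.
Qed.

Lemma raag_actM g h p : raag_act (g * h) p = raag_act g (raag_act h p).
Proof.
apply: (@pres_morph_ext _ _ raag _ (raag_act g \o raag_act h)) => [||x].
- exact: raag_act_morph.
- by move=> q r /=; rewrite !raag_act_morph.
- by rewrite /= !raag_act_gen sactM.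
Qed.

Definition raag_action : group_action Gamma raag :=
  GroupAction raag_act1 raag_actM raag_act_morph.

End RAAG.

(* Main.v *)
Require Import Defs.
From HB Require Import structures.
From mathcomp Require Import finmap boolp classical_sets cardinality.
From mathcomp Require Import all_boot all_fingroup zify.

(* The stabilizers being finite and the action cocompact, L is locally finite,
   so residual finiteness of Gamma yields a finite quotient F of Gamma such that
   a given reduced word of G_L stays reduced after its letters are replaced by
   their orbits under the kernel of Gamma -> F. A reduced word is detected by a
   finite quotient, compatible with every commutation, without any normal form
   theorem: sending v to the product of two non-commuting involutions maps it to
   a reduced word of a right-angled Coxeter group, and each Coxeter generator
   acts on the sets of positions of that word by adding or removing the unique
   position where this is possible, so that the word fills up the empty set one
   letter at a time. Inducing this action along G_L -> G_L ><| Gamma gives a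
   finite quotient of the semidirect product. *)

Set Implicit Arguments.
Unset Strict Implicit.
Unset Printing Implicit Defensive.

Local Open Scope group_scope.

(** * Coxeter generators acting on sets of positions of a reduced word *)

Section Toggle.
Variables (B : eqType) (comm : rel B) (x0 : B) (b : seq B).
Hypothesis comm_sym : symmetric comm.
Hypothesis b_reduced : forall i j, i < j < size b -> nth x0 b i = nth x0 b j ->
  exists2 z, i < z < j & ~~ comm (nth x0 b i) (nth x0 b z).

Implicit Types (s : B) (I : {set 'I_(size b)}).

(* On a down-set of the heap of b (i below j when i < j and the letters do not
   commute) this says that i can be added or removed within down-sets; in this
   form it makes sense for every I, so that toggle is a total involution. *)
Definition togglable s I (i : 'I_(size b)) : bool :=
  (nth x0 b i == s) &&
  [forall j : 'I_(size b),
     (j != i) && ~~ comm s (nth x0 b j) ==> ((j \in I) == (j < i))].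

Definition toggle s I : {set 'I_(size b)} :=
  [set j | (j \in I) (+) togglable s I j].

Lemma togglableP s I (i : 'I_(size b)) :
  reflect (nth x0 b i = s /\ forall j : 'I_(size b),
             j != i -> ~~ comm s (nth x0 b j) -> (j \in I) = (j < i))
          (togglable s I i).
Proof.
apply: (iffP andP) => -[/eqP bi H]; split=> //.
- by move=> j ji cj; apply/eqP; move/forallP/(_ j): H; rewrite ji cj.
- by apply/forallP => j; apply/implyP => /andP[ji cj]; rewrite H.
Qed.

(** The letter [z] that separates the equal letters at [i < j] lies above [i] and below [j]:
    togglability at [i] puts [z] outside [I], togglability at [j] puts it inside. *)
Lemma togglable_ltF s I (i j : 'I_(size b)) :
  togglable s I i -> togglable s I j -> i < j -> False.
Proof.
move=> /togglableP[bi Hi] /togglableP[bj Hj] ij.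
have ijb : i < j < size b by rewrite ij ltn_ord.
have [|z /andP[iz zj] cz] := b_reduced ijb; first by rewrite bi bj.
have zb : z < size b by apply: ltn_trans zj (ltn_ord j).
rewrite bi in cz.
have zi : Ordinal zb != i by rewrite -val_eqE /= gtn_eqF.
have zj' : Ordinal zb != j by rewrite -val_eqE /= ltn_eqF.
by have := Hi _ zi cz; rewrite (Hj _ zj' cz) /= zj ltnNge ltnW.
Qed.

Lemma togglable_inj s I i j : togglable s I i -> togglable s I j -> i = j.
Proof.
move=> Ti Tj; have [ij|ji|/val_inj //] := ltngtP i j.
- by case: (togglable_ltF Ti Tj ij).
- by case: (togglable_ltF Tj Ti ji).
Qed.

Lemma eq_togglable s I I' (i : 'I_(size b)) :
    (forall j : 'I_(size b),
       j != i -> ~~ comm s (nth x0 b j) -> (j \in I) = (j \in I')) ->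
  togglable s I i = togglable s I' i.
Proof.
move=> II'; apply/togglableP/togglableP => -[-> H]; split=> // j ji cj.
- by rewrite -II' ?H.
- by rewrite II' ?H.
Qed.

(** Toggling changes [I] at most at the unique togglable position, and togglability of a position
    never consults its own membership. So that position stays togglable, and by uniqueness no other
    becomes so. *)
Lemma togglable_toggle s I : togglable s (toggle s I) =1 togglable s I.
Proof.
have stable i : togglable s I i -> togglable s (toggle s I) i.
  move=> Ti; rewrite (@eq_togglable _ _ I) // => j ji _.
  rewrite inE; case: (boolP (togglable s I j)); rewrite ?addbF // => Tj.
  by rewrite (togglable_inj Tj Ti) eqxx in ji.
move=> i; apply/idP/idP => [Ti|]; last exact: stable.
have [[j Tj]|H] := pselect (exists j, togglable s I j).
  by rewrite (togglable_inj Ti (stable j Tj)).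
suff <- : toggle s I = I by [].
apply/setP => j; rewrite inE; case: (boolP (togglable s I j)) => [Tj|].
  by case: H; exists j.
by rewrite addbF.
Qed.

Lemma toggleK s : involutive (toggle s).
Proof.
by move=> I; apply/setP => j; rewrite !inE togglable_toggle -addbA addbb addbF.
Qed.

(** Toggling [s] changes only positions with letter [s], while togglability for [s'] consults only
    letters that do not commute with [s']. *)
Lemma togglable_comm s s' I :
  comm s s' -> togglable s' (toggle s I) =1 togglable s' I.
Proof.
move=> ss' i; apply: eq_togglable => j _ cj; rewrite inE.
case: (boolP (togglable s I j)); rewrite ?addbF // => /togglableP[bj _].
by rewrite bj comm_sym ss' in cj.
Qed.

Lemma toggle_comm s s' I :
  comm s s' -> toggle s (toggle s' I) = toggle s' (toggle s I).
Proof.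
move=> ss'; apply/setP => j; rewrite !inE !togglable_comm // 1?comm_sym //.
by rewrite addbAC.
Qed.

Lemma toggle_initial (k : 'I_(size b)) :
  toggle (nth x0 b k) [set j : 'I_(size b) | j < k] =
  [set j : 'I_(size b) | j < k.+1].
Proof.
(* On an initial segment of length [k], the membership required for togglability at [k] holds by
   definition. *)
have Tk : togglable (nth x0 b k) [set j : 'I_(size b) | j < k] k.
  by apply/togglableP; split=> // j _ _; rewrite inE.
apply/setP => j; rewrite !inE ltnS [RHS]leq_eqVlt.
have [/val_inj ->|jk] := eqVneq (j : nat) k; first by rewrite Tk ltnn.
case: (boolP (togglable _ _ j)) => [Tj|]; last by rewrite addbF.
by rewrite (togglable_inj Tj Tk) eqxx in jk.
Qed.

Definition toggle_perm s : {perm {set 'I_(size b)}} :=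
  perm (inv_inj (@toggleK s)).

Lemma prod_toggle_perm : (\prod_(s <- b) toggle_perm s) set0 = setT.
Proof.
have prefix k : k <= size b ->
    (\prod_(s <- take k b) toggle_perm s) set0 = [set j : 'I_(size b) | j < k].
  elim: k => [_|k IHk kb].
    by rewrite take0 big_nil perm1; apply/setP => j; rewrite !inE.
  rewrite (take_nth x0) // -cats1 big_cat big_seq1 permM IHk ?(ltnW kb) //.
  by rewrite permE (toggle_initial (Ordinal kb)).
have := prefix _ (leqnn _); rewrite take_size => ->.
by apply/setP => j; rewrite !inE ltn_ord.
Qed.

End Toggle.

Lemma coxeter_finite_image (B : eqType) (comm : rel B) (x0 : B) (b : seq B) :
    symmetric comm ->
    (forall i j, i < j < size b -> nth x0 b i = nth x0 b j ->
      exists2 z, i < z < j & ~~ comm (nth x0 b i) (nth x0 b z)) ->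
    b != [::] ->
  exists (Q : finGroupType) (t : B -> Q),
    [/\ forall s, t s * t s = 1,
        forall s s', comm s s' -> t s * t s' = t s' * t s
      & \prod_(s <- b) t s != 1].
Proof.
move=> comm_sym b_red b0.
exists {perm {set 'I_(size b)}}, (toggle_perm b_red); split.
- by move=> s; apply/permP => I; rewrite permM !permE toggleK.
- move=> s s' ss'; apply/permP => I; rewrite !permM !permE.
  by rewrite toggle_comm // comm_sym.
- have b_gt0 : 0 < size b by rewrite lt0n size_eq0.
  apply/eqP => p1; have := prod_toggle_perm b_red; rewrite p1 perm1.
  by move/setP/(_ (Ordinal b_gt0)); rewrite !inE.
Qed.

(** * Reduced Artin words and their doubling into reduced Coxeter words *)

Definition reduced (K : eqType) (C : rel K) (w : word K) : Prop :=
  forall a0 p q, p < q < size w ->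
    (nth a0 w p).1 = (nth a0 w q).1 -> (nth a0 w p).2 != (nth a0 w q).2 ->
  exists2 z, p < z < q & ~~ C (nth a0 w p).1 (nth a0 w z).1.

(* With v = (v, false) (v, true) a product of two involutions, v^-1 is the same
   product in the other order. *)
Definition doubled (K : Type) (w : word K) : word K :=
  flatten [seq [:: a; (a.1, ~~ a.2)] | a <- w].

Lemma size_doubled (K : Type) (w : word K) : size (doubled w) = (size w).*2.
Proof. by elim: w => //= a w ->. Qed.

Lemma nth_doubled (K : Type) (a0 : K * bool) (w : word K) i :
  i < (size w).*2 ->
  nth a0 (doubled w) i = ((nth a0 w i./2).1, (nth a0 w i./2).2 (+) odd i).
Proof.
elim: w i => // a w IHw [|[|i]] /=;
  rewrite ?addbF ?addbT ?negbK -?surjective_pairing //.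
by rewrite !ltnS => /IHw ->.
Qed.

Definition letter_comm (K : Type) (C : rel K) : rel (K * bool) :=
  fun a a' => C a.1 a'.1.

(** If [i] and [j] have the same parity, the partner [i.+1] or [j.-1] lies between them and carries
    the same vertex, which does not commute with itself. If the parities differ, the original
    letters are mutually inverse, so a separator [z] in [w] gives the separator [z.*2]. *)
Lemma doubled_reduced (K : eqType) (C : rel K) (w : word K) a0 i j :
    reduced C w -> (forall a, a \in w -> ~~ C a.1 a.1) ->
    i < j < size (doubled w) ->
    nth a0 (doubled w) i = nth a0 (doubled w) j ->
  exists2 z, i < z < j &
    ~~ letter_comm C (nth a0 (doubled w) i) (nth a0 (doubled w) z).
Proof.
rewrite size_doubled => w_red w_irr /andP[ij jw].
have iw := ltn_trans ij jw; have iw2 : i./2 < size w by lia.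
rewrite !nth_doubled // => -[e1 e2].
have ii := w_irr _ (mem_nth a0 iw2).
have nij : odd i = odd j -> i./2 < j./2 by lia.
have [eo|no] := eqVneq (odd i) (odd j).
  case oi: (odd i) eo e2 => eo e2.
    by exists j.-1; [lia | rewrite /letter_comm nth_doubled; [|lia];
      have ->: j.-1./2 = j./2 by [lia]; rewrite /= -e1].
  by exists i.+1; [lia | rewrite /letter_comm nth_doubled; [|lia];
    have ->: i.+1./2 = i./2 by lia].
have [hij|hij] := eqVneq i./2 j./2.
  by move: e2 no; rewrite hij => /addbI ->; rewrite eqxx.
have [||z zij cz] := w_red a0 i./2 j./2 _ e1.
- lia.
- by apply: contraNneq no => e; move: e2; rewrite e => /addbI ->.
exists z.*2; first lia.
by rewrite /letter_comm nth_doubled ?doubleK //; lia.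
Qed.

Lemma raag_finite_image (K : choiceType) (C : rel K) (w : word K) :
    symmetric C -> reduced C w -> (forall a, a \in w -> ~~ C a.1 a.1) ->
    w != [::] ->
  exists (Q : finGroupType) (c : K -> Q),
    (forall x y, C x y -> c x * c y = c y * c x) /\ word_eval c w != 1.
Proof.
move=> C_sym w_red w_irr w0.
have [a0 _] : exists a0, a0 \in w.
  by case: w w0 {w_red w_irr} => // a w _; exists a; rewrite mem_head.
have [|||Q [t [t_inv t_comm t_w]]] :=
  @coxeter_finite_image _ (letter_comm C) a0 (doubled w).
- by move=> a a'; exact: C_sym.
- by move=> i j; exact: doubled_reduced.
- by rewrite -size_eq0 size_doubled double_eq0 size_eq0.
have tV s : (t s)^-1 = t s by apply: (mulgI (t s)); rewrite mulgV t_inv.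
exists Q, (fun x => t (x, false) * t (x, true)); split.
  by move=> x y xy; apply: commuteM; apply: commute_sym; apply: commuteM;
    apply: t_comm; rewrite /letter_comm /= C_sym.
suff -> : word_eval (fun x => t (x, false) * t (x, true)) w =
          \prod_(s <- doubled w) t s by [].
rewrite /word_eval big_flatten big_map; apply: eq_bigr => -[x e] _ /=.
by rewrite !big_cons big_nil mulg1; case: e; rewrite //= invMg !tV.
Qed.

Lemma pres_class_letter (V : choiceType) (R : word V -> word V -> Prop) x e :
  pres_class R [:: (x, e)] = if e then (pres_gen R x)^-1 else pres_gen R x.
Proof. by case: e => //; exact: (pres_class_inv R [:: (x, false)]). Qed.

(** * Reduced representatives of elements of $G_L$ *)

Section RaagWords.
Variables (V : choiceType) (L : simplicial_complex V).

Definition edgeb : rel V := fun x y => `[< edge L x y >].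

Lemma edge_sym x y : edge L x y -> edge L y x.
Proof. by move=> [xy Lxy]; split; rewrite 1?eq_sym 1?fsetUC. Qed.

Lemma raag_letter_comm x e (u : word V) :
    (forall a, a \in u -> edge L x a.1) ->
  commute (pres_class (raag_rel L) [:: (x, e)] : raag L)
          (pres_class (raag_rel L) u).
Proof.
elim: u => [|[y e'] u IHu] xu; first exact: (@commute1 (raag L)).
rewrite -[_ :: u]cat1s pres_classM; apply: (@commuteM (raag L)); last first.
  by apply: IHu => a au; apply: xu; rewrite inE au orbT.
have xy : commute (raag_gen L x) (raag_gen L y).
  by apply: raag_gen_comm; apply: (xu (y, e')); rewrite mem_head.
have xey : commute (pres_class (raag_rel L) [:: (x, e)] : raag L)
                   (raag_gen L y).
  rewrite pres_class_letter; case: e {IHu xu} => //.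
  exact/commute_sym/commuteV/commute_sym.
rewrite [X in commute _ X]pres_class_letter; case: e' {xu} => //.
exact: commuteV.
Qed.

(** A shortest representative works: were two inverse letters separated only by neighbours of their
    vertex, one could be moved next to the other and cancelled. *)
Lemma raag_reduced_word (n : raag L) :
  exists w, pres_class (raag_rel L) w = n /\ reduced edgeb w.
Proof.
pose P k := `[< exists w, pres_class (raag_rel L) w = n /\ size w = k >].
have exP : exists k, P k.
  by exists (size (pres_repr n)); apply/asboolP; exists (pres_repr n);
    rewrite pres_reprK.
case: (ex_minnP exP) => k /asboolP[w [wn <-]] min_w; exists w; split=> //.
move=> a0 p q /andP[pq qw] e1 e2; apply: contrapT => noz.
have pw := ltn_trans pq qw.
(* The letters strictly between [p] and [q]. *)
pose u := take (q - p.+1) (drop p.+1 w).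
have su : size u = q - p.+1.
  by rewrite size_takel // size_drop leq_sub2r // ltnW.
have ws : w = take p w ++ [:: nth a0 w p] ++ u ++ [:: nth a0 w q] ++
              drop q.+1 w.
  rewrite -{1}(cat_take_drop p w) (drop_nth a0 pw) -cat1s.
  congr (_ ++ (_ ++ _)).
  rewrite -{1}(cat_take_drop (q - p.+1) (drop p.+1 w)) drop_drop subnK //.
  by rewrite (drop_nth a0 qw).
have xu a : a \in u -> edge L (nth a0 w p).1 a.1.
  move=> /(nthP a0)[i]; rewrite su => iu <-.
  rewrite nth_take // nth_drop; apply: contrapT => nxa; apply: noz.
  by exists (p.+1 + i); [lia | apply/asboolPn].
have w'n : pres_class (raag_rel L) (take p w ++ u ++ drop q.+1 w) = n.
  rewrite -wn [in RHS]ws !pres_classM; congr (_ * _); rewrite !mulgA.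
  congr (_ * _).
  move: (raag_letter_comm (nth a0 w p).2 xu); rewrite -surjective_pairing => ->.
  rewrite -mulgA -[LHS]mulg1; congr (_ * _).
  rewrite -pres_classM -pres_class1; apply/pres_classP/PresSym.
  rewrite [nth a0 w p]surjective_pairing [nth a0 w q]surjective_pairing -e1.
  have -> : (nth a0 w q).2 = ~~ (nth a0 w p).2 by case: (_.2) (_.2) e2 => [] [].
  exact: PresCancel.
have : P (size (take p w ++ u ++ drop q.+1 w)).
  by apply/asboolP; exists (take p w ++ u ++ drop q.+1 w).
by move/min_w; rewrite !size_cat su (size_takel (ltnW pw)) size_drop;
  move: pq qw; clear; move: (size w) => m; lia.
Qed.

End RaagWords.

Definition multiplicative_of (G H : magmaType) (f : G -> H)
    (fM : {morph f : x y / x * y}) : {multiplicative G -> H} :=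
  HB.pack f (isMultiplicative.Build G H f fM).

Lemma multiplicative1 (G H : groupType) (f : {multiplicative G -> H}) : f 1 = 1.
Proof. by apply: (mulgI (f 1)); rewrite -gmulfM !mulg1. Qed.

Lemma multiplicativeV (G H : groupType) (f : {multiplicative G -> H}) x :
  f x^-1 = (f x)^-1.
Proof. by apply: (mulgI (f x)); rewrite -gmulfM !mulgV multiplicative1. Qed.

(** * Inducing finite images of $G_L$ to the semidirect product *)

Section SemidirectImage.
Variables (Gamma : groupType) (V : choiceType) (L : simplicial_complex V).
Variables (A : simplicial_action Gamma L) (F Q : finGroupType).
Variables (h : {multiplicative Gamma -> F}) (c : F -> V -> Q).
Hypothesis c_comm : forall f x y, edge L x y -> c f x * c f y = c f y * c f x.
Hypothesis c_equiv : forall g f x, c (h g * f) (A g x) = c f x.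

Lemma colour_rel f u v :
  raag_rel L u v -> word_eval (c f) u = word_eval (c f) v.
Proof.
by case=> x y xy; rewrite /word_eval !big_cons big_nil !mulg1 /= c_comm.
Qed.

Let phi f : raag L -> Q := pres_lift (c f).

Lemma phiM f : {morph phi f : m n / m * n}.
Proof. exact: pres_liftM (@colour_rel f). Qed.

Lemma phi_gen f x : phi f (raag_gen L x) = c f x.
Proof. exact: pres_lift_gen (@colour_rel f) x. Qed.

(** The action permutes the homomorphisms [phi f] through [F], which makes [induced_act] compatible
    with products. Both sides are morphisms in [n], so [c_equiv] on generators suffices. *)
Lemma phi_act f g n : phi f (raag_act A g n) = phi ((h g)^-1 * f) n.
Proof.
apply: (@pres_morph_ext _ _ Q (phi f \o raag_act A g)) => [m n'||x].
- by rewrite /= raag_act_morph phiM.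
- exact: phiM.
rewrite /= raag_act_gen phi_gen -/(raag_gen L x) phi_gen.
by rewrite -[RHS](c_equiv g) mulKVg.
Qed.

(* A right action, as permutations compose from left to right in mathcomp. *)
Definition induced_act (p : semidirect (raag_action A)) (z : Q * F) : Q * F :=
  (z.1 * phi z.2 p.1, (h p.2)^-1 * z.2).

Lemma induced_act_inj p : injective (induced_act p).
Proof.
by move=> [q f] [q' f'] [] /[swap] /mulgI <- /mulIg ->.
Qed.

Definition induced_perm p : {perm Q * F} := perm (@induced_act_inj p).

Lemma induced_permM : {morph induced_perm : p p' / p * p'}.
Proof.
move=> [n g] [n' g']; apply/permP => -[q f]; rewrite permM !permE.
by rewrite /induced_act /= phiM phi_act gmulfM invMg !mulgA.
Qed.

Lemma semidirect_finite_image (n : raag L) : pres_lift (c 1) n != 1 ->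
  exists (P : finGroupType)
      (f : {multiplicative semidirect (raag_action A) -> P}),
    f (n, 1) != 1.
Proof.
move=> n1; exists {perm Q * F}, (multiplicative_of induced_permM).
(* The first coordinate of the image of [(1, 1)] is [phi 1 n]. *)
apply: contra_neq n1 => /permP/(_ (1, 1)); rewrite permE perm1.
by case; rewrite mul1g.
Qed.

End SemidirectImage.

(** Take the direct product of the finite quotients that detect the single elements, starting from
    the trivial group [{perm 'I_1}]. *)
Lemma residually_finite_seq (G : groupType) (s : seq G) :
    residually_finite G -> 1 \notin s ->
  exists (Q : finGroupType) (h : {multiplicative G -> Q}),
    forall x, x \in s -> h x != 1.
Proof.
move=> rfG; elim: s => [_|x s IHs].
  have h1M : {morph (fun _ : G => 1 : {perm 'I_1}) : x y / x * y}.
    by move=> *; rewrite mulg1.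
  by exists {perm 'I_1}, (multiplicative_of h1M).
rewrite inE negb_or eq_sym => /andP[/rfG[Q1 [h1 h1x]] /IHs[Q2 [h2 h2s]]].
have hM : {morph (fun y : G => (h1 y, h2 y) : Q1 * Q2) : y z / y * z}.
  by move=> y z; rewrite !gmulfM.
exists (Q1 * Q2)%type, (multiplicative_of hM) => y.
rewrite inE => /orP[/eqP->|/h2s].
- by apply: contra_neq h1x; case.
- by apply: contra_neq; case.
Qed.

(** * Local finiteness from cocompactness and finite stabilizers *)

Section Transporters.
Local Open Scope classical_set_scope.

Lemma finite_fibers (T U : Type) (X : set T) (f : T -> U) :
    finite_set (f @` X) ->
    (forall x, X x -> finite_set [set y | X y /\ f y = f x]) ->
  finite_set X.
Proof.
move=> fX fib; apply: (@sub_finite_set _ _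
  (\bigcup_(u in f @` X) [set y | X y /\ f y = u])).
  by move=> x Xx; exists (f x) => //; exists x.
by apply: bigcup_finite => // _ [x Xx <-]; exact: fib.
Qed.

Variables (Gamma : groupType) (V : choiceType) (L : simplicial_complex V).
Variable A : simplicial_action Gamma L.
Hypothesis A_cocompact : cocompact A.
Hypothesis A_stab : finite_stabilizers A.

(** A nonempty transporter is a coset of the stabilizer of [x]. *)
Lemma finite_vertex_transporter x y : finite_set [set g | A g x = y].
Proof.
have [[g0 g0x]|none] := pselect (exists g, A g x = y); last first.
  apply: (@sub_finite_set _ _ classical_sets.set0); last exact: finite_set0.
  by move=> g gx; apply: none; exists g.
apply: (@sub_finite_set _ _ (mulg g0 @` simplex_stabilizer A [fset x]%fset)).
  move=> g gx; exists (g0^-1 * g); last by rewrite mulKVg.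
  rewrite /simplex_stabilizer /= /simplex_act imfset_fset1 sactM gx -g0x.
  by rewrite -sactM mulVg sact1.
exact/finite_image/A_stab/simplex_vertex.
Qed.

Lemma finite_edge_transporter x y : finite_set [set g | edge L x (A g y)].
Proof.
apply: (@finite_fibers _ _ _ (fun g => simplex_orbit A [fset x; A g y]%fset)).
  apply: sub_finite_set A_cocompact => _ [g [_ Lg] <-].
  by exists [fset x; A g y]%fset.
(* The edges from [x] to [A g y] fall into finitely many orbits. Within the orbit of [g0], some [k]
   carries the edge of [g0] to that of [g], and either fixes [x] or sends [A g0 y] to [x]: finitely
   many [k], and finitely many [g] for each. *)
move=> g0 [xg0 _]; apply: (@sub_finite_set _ _
   ((\bigcup_(k in [set k | A k x = x]) [set g | A g y = A k (A g0 y)]) `|`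
    (\bigcup_(k in [set k | A k (A g0 y) = x]) [set g | A g y = A k x]))).
  move=> g [[xg _] og].
  have : simplex_orbit A [fset x; A g y]%fset [fset x; A g y]%fset.
    exists 1 => //; rewrite /simplex_act imfsetU !imfset_fset1.
    by rewrite !sact1.
  rewrite og => -[k _]; rewrite /simplex_act imfsetU !imfset_fset1 => /fsetP E.
  have xE : x \in [fset A k x; A k (A g0 y)]%fset by rewrite E in_fset2 eqxx.
  have yE : A g y \in [fset A k x; A k (A g0 y)]%fset.
    by rewrite E in_fset2 eqxx orbT.
  move: yE xE; rewrite !in_fset2 => /orP[]/eqP gy /orP[]/eqP xk.
  - by rewrite gy -xk eqxx in xg.
  - by right; exists k.
  - by left; exists k.
  - by rewrite gy -xk eqxx in xg.
rewrite finite_setU; split; apply: bigcup_finite => *;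
  exact: finite_vertex_transporter.
Qed.

End Transporters.

(** * Colouring vertices by orbits under the kernel of a finite quotient *)

Section CosetOrbits.
Variables (Gamma : groupType) (V : choiceType) (L : simplicial_complex V).
Variable A : simplicial_action Gamma L.

(* Words with letters in s stay reduced modulo a subgroup that avoids these
   elements. *)
Lemma finite_collapse (s : seq V) : cocompact A -> finite_stabilizers A ->
  finite_set (fun g => exists x y, [/\ x \in s, y \in s &
    A g y = x /\ x != y \/ edge L x (A g y) /\ ~ edge L x y]).
Proof.
move=> A_cocompact A_stab.
apply: (@sub_finite_set _ _ (\bigcup_(x in [set` s]) \bigcup_(y in [set` s])
  ([set g | A g y = x] `|` [set g | edge L x (A g y)])))%classic.
  move=> g [x [y [xs ys H]]]; exists x => //; exists y => //.
  by case: H => -[H _]; [left | right].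
apply: bigcup_finite => [|x _]; first exact: finite_seq.
apply: bigcup_finite => [|y _]; first exact: finite_seq.
rewrite finite_setU; split; first exact: finite_vertex_transporter.
exact: finite_edge_transporter.
Qed.

Variables (F : finGroupType) (h : {multiplicative Gamma -> F}).

(* The orbit of x under the kernel of h when f = 1; empty when f is not in the
   image of h, in which case all vertices get the same label. *)
Definition coset_orbit (f : F) (x : V) : set V :=
  fun z => exists2 g, h g = f & z = A g^-1 x.

(** Adjacency in the quotient of [L]. It may have loops, so irreflexivity has to be secured for the
    letters of the given word. *)
Definition coset_orbit_edge : rel (set V) :=
  fun X Y => `[< exists x y, [/\ X x, Y y & edge L x y] >].

Lemma coset_orbit_edge_sym : symmetric coset_orbit_edge.
Proof.
move=> X Y; apply/asboolP/asboolP => -[x [y [Xx Yy xy]]];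
  by exists y, x; split=> //; exact: edge_sym.
Qed.

Lemma coset_orbit_equiv g f x : coset_orbit (h g * f) (A g x) = coset_orbit f x.
Proof.
apply/funext => z; apply/propext; split=> -[k hk ->].
  exists (g^-1 * k); last by rewrite invMg invgK sactM.
  by rewrite gmulfM multiplicativeV hk mulKg.
exists (g * k); rewrite ?gmulfM ?hk // invMg sactM.
by rewrite -(sactM A g^-1) mulVg sact1.
Qed.

Lemma coset_orbit1 x : coset_orbit 1 x x.
Proof. by exists 1; rewrite ?multiplicative1 // invg1 sact1. Qed.

(** The second alternative serves for [f] outside the image of [h]; equal labels get equal colours,
    which commute too. *)
Lemma coset_orbit_edgeP f x y : edge L x y ->
  coset_orbit_edge (coset_orbit f x) (coset_orbit f y) \/
  coset_orbit f x = coset_orbit f y.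
Proof.
move=> xy; have [[g hg]|none] := pselect (exists g, h g = f).
  left; apply/asboolP; exists (A g^-1 x), (A g^-1 y).
  by split; [exists g | exists g | exact: sact_edge].
right; apply/funext => z; apply/propext.
by split=> -[k hk _]; case: none; exists k.
Qed.

(** The last hypothesis says that the kernel of [h] neither merges letters of [w] nor creates edges
    between them, so the word of labels is still reduced. *)
Lemma detect_reduced_word (w : word V) :
    reduced (edgeb L) w -> w != [::] ->
    (forall g x y, x \in [seq a.1 | a <- w] -> y \in [seq a.1 | a <- w] ->
       h g = 1 -> (A g y = x -> x = y) /\ (edge L x (A g y) -> edge L x y)) ->
  exists (P : finGroupType)
         (f : {multiplicative semidirect (raag_action A) -> P}),
    f (pres_class (raag_rel L) w, 1) != 1.
Proof.
move=> w_red w0 h_sep.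
have sep_eq x y : x \in [seq a.1 | a <- w] -> y \in [seq a.1 | a <- w] ->
    coset_orbit 1 x = coset_orbit 1 y -> x = y.
  move=> xw yw xy; have := coset_orbit1 x; rewrite xy => -[g hg /esym].
  by apply: (h_sep _ _ _ xw yw _).1; rewrite multiplicativeV hg invg1.
have sep_edge x y : x \in [seq a.1 | a <- w] -> y \in [seq a.1 | a <- w] ->
    coset_orbit_edge (coset_orbit 1 x) (coset_orbit 1 y) -> edge L x y.
  move=> xw yw /asboolP[_ [_ [[g hg ->] [k hk ->]]]] /(sact_edge A g).
  rewrite -!sactM mulgV sact1; apply: (h_sep _ _ _ xw yw _).2.
  by rewrite gmulfM multiplicativeV hg hk invg1 mulg1.
pose w' := [seq (coset_orbit 1 a.1, a.2) | a <- w].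
have [||||Q [c [c_comm c_w]]] := @raag_finite_image _ coset_orbit_edge w'.
- exact: coset_orbit_edge_sym.
- have [a0 _] : exists a0, a0 \in w.
    by case: (w) w0 => // a u _; exists a; rewrite mem_head.
  move=> a0' p q; rewrite size_map => /andP[pq qw].
  have letter k : k < size w -> (nth a0 w k).1 \in [seq a.1 | a <- w].
    by move=> kw; apply/map_f/mem_nth.
  have pw := ltn_trans pq qw; rewrite !(nth_map a0) //= => e1 e2.
  have [||z /andP[pz zq] Cz] := w_red a0 p q _ _ e2; first by rewrite pq.
    by apply: sep_eq e1; exact: letter.
  have zw := ltn_trans zq qw; exists z; first by rewrite pz.
  rewrite (nth_map a0) //=; apply: contra Cz => Cz; apply/asboolP.
  by apply: sep_edge Cz; exact: letter.
(* A loop at the label of a letter would come from a loop in [L]. *)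
- move=> _ /mapP[a aw ->]; apply/negP => /= /sep_edge.
  by case; rewrite ?map_f // eqxx.
- by rewrite -size_eq0 size_map size_eq0.
pose colour f x := c (coset_orbit f x).
have colour_comm f x y : edge L x y ->
    colour f x * colour f y = colour f y * colour f x.
  by rewrite /colour => /(coset_orbit_edgeP f)[/c_comm|->].
apply: (@semidirect_finite_image _ _ _ _ _ _ h colour) => // [g f x|].
  by rewrite /colour coset_orbit_equiv.
rewrite (pres_lift_class (@colour_rel _ _ _ _ _ colour_comm 1)).
by rewrite /word_eval big_map in c_w.
Qed.

End CosetOrbits.

Theorem theorem25 (Gamma : groupType) (V : choiceType)
    (L : simplicial_complex V) (A : simplicial_action Gamma L) :
  residually_finite Gamma ->
  flag_complex L ->
  cocompact A ->
  finite_stabilizers A ->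
  residually_finite (semidirect (raag_action A)).
Proof.
move=> rfGamma _ A_cocompact A_stab [n g] ng1.
have [g1|g1] := eqVneq g 1; last first.
  have [F [h hg]] := rfGamma g g1.
  have hM : {morph (fun p : semidirect (raag_action A) => h p.2) : p q / p * q}.
    by move=> p q; rewrite -gmulfM.
  by exists F, (multiplicative_of hM).
have [w [wn w_red]] := raag_reduced_word n.
have w0 : w != [::] by apply: contra_neq ng1 => w0; rewrite -wn w0 g1.
(* [T] lists the group elements that merge distinct letters of [w] or create an edge between them; a
   finite quotient that kills none of them has a suitable kernel. *)
have /finite_seqP[T TE] :=
  finite_collapse [seq a.1 | a <- w] A_cocompact A_stab.
have T1 : 1 \notin T.
  apply/negP => T1; have : [set` T]%classic 1 by [].
  rewrite -TE => -[x [y [_ _]]]; rewrite sact1 => -[[-> /eqP]|[]] //.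
have [F [h hT]] := residually_finite_seq rfGamma T1.
rewrite g1 -wn.
apply: (detect_reduced_word w_red w0 (h := h)) => k x y xw yw hk.
have kT : ~ [set` T]%classic k by move=> /hT; rewrite hk eqxx.
rewrite -TE in kT; split=> H; apply: contrapT => nH; apply: kT.
- by exists x, y; split=> //; left; split=> //; apply/eqP.
- by exists x, y; split=> //; right.
Qed.
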